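(* Let $n$ be a positive integer and let $G_n$ denote the set of decorated permutations on $[n]$ with at least one fixed point, either signed or unsigned. For $\pi\in G_n$, let $\operatorname{nfix}(\pi)$ denote the number of signed fixed points of $\pi$. Then $$\sum_{\pi\in G_n}(-1)^{\operatorname{nfix}(\pi)}q^{\operatorname{maj}(\pi)}=0.$$
   Context: Write $[n]=\{1,2,\ldots,n\}$. A decorated permutation on $[n]$ is a permutation $\pi=\pi_1\cdots\pi_n$ of $[n]$ in which each fixed point (an $i$ with $\pi_i=i$) is either left unsigned or assigned a minus sign; a signed fixed point $i$ is written $\overline{i}$. Thus a decorated permutation is a word $\pi_1\cdots\pi_n$ in which the letter at position $i$ may be $\overline{i}$ instead of $i$ when $i$ is a fixed point. Nonfixed points are never signed. Decorated permutations are regarded as words in the totally ordered alphabet $\overline{n}<\cdots<\overline{2}<\overline{1}<1<2<\cdots<n$. With respect to this order, $\operatorname{Des}(\pi)=\{i : 1\le i\le n-1,\ \pi_i>\pi_{i+1}\}$ and $\operatorname{maj}(\pi)=\sum_{i\in\operatorname{Des}(\pi)} i$. *)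

(* Defs.v *)
From HB Require Import structures.
From mathcomp Require Import all_boot all_order all_fingroup all_algebra.

Set Implicit Arguments.
Unset Strict Implicit.
Unset Printing Implicit Defensive.

Import Order.TTheory GRing.Theory Num.Theory.
Local Open Scope ring_scope.

(* A decorated permutation is a pair of a permutation and the set of its
   signed positions, all of which must be fixed points. The letters 1, ..., n
   are represented by 'I_n, so k : 'I_n stands for k.+1. *)
Record decperm (n : nat) := DecPerm {
  dp_val : 'S_n * {set 'I_n};
  _ : dp_val.2 \subset [set i | dp_val.1 i == i]
}.

HB.instance Definition _ n := [isSub for @dp_val n].
HB.instance Definition _ n := [Finite of decperm n by <:].

Definition dp_perm n (d : decperm n) : 'S_n := (dp_val d).1.
Definition dp_signed n (d : decperm n) : {set 'I_n} := (dp_val d).2.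

(* The unsigned letter k is the integer k and the signed letter k the integer
   - k, so that the alphabet order is the usual order on the integers. *)
Definition dp_letter n (d : decperm n) (i : 'I_n) : int :=
  if i \in dp_signed d then - i.+1%:Z else (dp_perm d i).+1%:Z.

Definition dp_word n (d : decperm n) : seq int :=
  [seq dp_letter d i | i <- enum 'I_n].

(* Positions in a word are counted from 1, whereas nth counts from 0. *)
Definition Des (w : seq int) : seq nat :=
  [seq i <- iota 1 (size w).-1 | nth 0 w i.-1 > nth 0 w i].

Definition maj (w : seq int) : nat := (\sum_(i <- Des w) i)%N.

Definition nfix n (d : decperm n) : nat := #|dp_signed d|.

Definition G n : {set decperm n} := [set d | [exists i, dp_perm d i == i]].

(* Main.v *)
Require Import Defs.
From mathcomp Require Import all_boot all_order all_fingroup all_algebra.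
From mathcomp Require Import zify ring.

Import Order.TTheory GRing.Theory Num.Theory.
Local Open Scope ring_scope.
Set Implicit Arguments.
Unset Strict Implicit.
Unset Printing Implicit Defensive.

(** A decorated permutation with a fixed point is obtained in exactly one way
    by inserting a letter, signed or unsigned, as a new least fixed point [a]
    into a smaller decorated permutation [e] (lemmas [insert_fixed_inj] and
    [insert_fixed_onto]). Flipping the sign of the inserted letter changes the
    sign of the summand, so it is enough to show that, for each given [e], the
    signed and the unsigned insertions have the same distribution of [maj].
    In fact they have the same distribution of descent sets.

    To see this, give the boundary between two consecutive positions [i-1] and
    [i] (counted from 0) a free weight [p i], and a word the product of the
    weights of its descents; [p i = q^i] gives [q^maj]. Inserting a letter at
    [a] renumbers the other letters monotonically, so the weight only changes
    at the two boundaries that touch [a], and by the shift of the boundaries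
    after [a]. A signed letter at [a] is smaller than all letters to its left
    and than all letters to its right except signed ones. An unsigned one is
    compared with its neighbours according to whether these are deficient
    (letter smaller than its position), excedant, or fixed.

    The combinatorial reason is visible when all [p i] are 0 or 1: cut the
    positions into pieces at the boundaries of weight 1; then the weight of a
    word is 1 if it increases on every piece, and 0 otherwise. On an increasing
    piece the deficient letters precede the unsigned fixed points, which
    precede the excedant letters, and a signed fixed point must come first.
    Hence a signed fixed point can be moved across the deficient letters that
    follow it and lose its sign, and conversely. Moving it across one
    deficient letter at a time gives a correction term [defect a] with

      unsigned(a) + defect (a+1) = signed(a) + defect a

    (lemma [insert_step]). This telescopes over the admissible positions [a],
    and [defect] vanishes at both ends, which proves [insert_sum]. *)

(** * Weights of words under insertion of a letter *)

(** At [i = 0] the predecessor is truncated, so that this factor is [1]. *)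
Definition descent_factor (R : comNzRingType) (p : nat -> R) (w : nat -> int)
    (i : nat) : R :=
  if w i < w i.-1 then p i else 1.

(** The renumbering of the letters of a word when a fixed point is inserted at
    the position [a], counted from 0. *)
Definition shift_letter (a : nat) (l : int) : int :=
  if a%:Z < l then l + 1 else if l < - a%:Z then l - 1 else l.

Definition insert_letter (w : nat -> int) (a : nat) (x : int) (i : nat) : int :=
  if (i < a)%N then shift_letter a (w i)
  else if i == a then x else shift_letter a (w i.-1).

(** In the word of a decorated permutation the letter at a position, counted
    from 0, has absolute value [i.+1] exactly if [i] is a fixed point. *)
Definition nofix_below (w : nat -> int) (a : nat) : bool :=
  all (fun i => `|w i|%N != i.+1) (iota 0 a).

Lemma ltr_shift_letter a : {mono shift_letter a : x y / x < y}.
Proof.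
move=> x y; rewrite /shift_letter.
by repeat (case: ifP => ?); apply/idP/idP => ?; lia.
Qed.

Lemma nofix_belowS w a :
  nofix_below w a.+1 = nofix_below w a && (`|w a|%N != a.+1).
Proof.
by rewrite /nofix_below -{1}[a.+1]addn1 iotaD all_cat /= add0n andbT.
Qed.

Section Telescope.

Variables (R : comNzRingType) (p : nat -> R) (m : nat) (w : nat -> int).

Let before a := \prod_(0 <= i < a) descent_factor p w i.
Let after a := \prod_(a <= i < m.+1) descent_factor (fun i => p i.+1) w i.

(** Away from the inserted letter the descents are those of [w], since
    [shift_letter] is increasing; the boundaries to its right move by one. *)
Lemma prod_insert a x : (a <= m)%N ->
  \prod_(0 <= i < m.+2) descent_factor p (insert_letter w a x) i =
    before a * after a.+1 * descent_factor p (insert_letter w a x) a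
      * descent_factor p (insert_letter w a x) a.+1.
Proof.
move=> le_am; rewrite (@big_cat_nat _ _ _ a) //=; last lia.
rewrite [X in _ * X]big_ltn; last lia.
rewrite [X in _ * (_ * X)]big_ltn; last lia.
have ->: \prod_(0 <= i < a) descent_factor p (insert_letter w a x) i = before a.
  apply: eq_big_nat => i /andP[_ lt_ia].
  rewrite /descent_factor /insert_letter lt_ia.
  rewrite (leq_ltn_trans (leq_pred i) lt_ia).
  by rewrite ltr_shift_letter.
have ->: \prod_(a.+2 <= i < m.+2) descent_factor p (insert_letter w a x) i =
         after a.+1.
  rewrite big_add1 /=; apply: eq_big_nat => i /andP[lt_ai _].
  rewrite /descent_factor /insert_letter.
  have [-> ->] : (i.+1 < a)%N = false /\ (i.+1 == a)%N = false by lia.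
  have [-> ->] : (i < a)%N = false /\ (i == a)%N = false by lia.
  by rewrite ltr_shift_letter.
ring.
Qed.

Hypothesis letters : forall i, (i < m)%N -> 0 < w i \/ w i = - i.+1%:Z.
(* There is no boundary at either end of the word: a weight equal to 1 makes
   the comparison with the default letter there irrelevant. *)
Hypotheses (p0 : p 0 = 1) (pm : p m.+1 = 1).

(** The term carried from one insertion position to the next. It is present
    if the letter before [a] is deficient. For weights 0 and 1 the factor
    [1 - p a] says that this letter and the inserted one lie in the same piece,
    so that one may be moved across the other; the letters of [w] are compared
    with each other as if the inserted letter were absent. *)
Definition defect a : R :=
  (nofix_below w a && (0 < w a.-1 <= a%:Z))%:R * (1 - p a) * before a * after a.

(** Both sides share the factors away from [a], so this is an identity between
    the weights at two boundaries. It is checked by cases on the letters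
    around [a]: deficient or excedant to the left; signed, deficient or larger
    to the right. Wherever a correction term involves the comparison of these
    two letters, their types decide it, unless both are deficient; then both
    correction terms are present and balance. *)
Lemma insert_step a : (a <= m)%N -> nofix_below w a ->
  \prod_(0 <= i < m.+2) descent_factor p (insert_letter w a a.+1%:Z) i
    + defect a.+1 =
  \prod_(0 <= i < m.+2) descent_factor p (insert_letter w a (- a.+1%:Z)) i
    + defect a.
Proof.
move=> le_am nofix; rewrite !prod_insert // /defect nofix_belowS nofix /=.
have -> : before a.+1 = before a * descent_factor p w a.
  by rewrite /before big_nat_recr.
have -> : after a = descent_factor (fun i => p i.+1) w a * after a.+1.
  by rewrite /after big_ltn.
move: (before a) (after a.+1) => B C.
pose ends x := descent_factor p (insert_letter w a x) a
               * descent_factor p (insert_letter w a x) a.+1.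
suff balance :
    ends a.+1%:Z + ((`|w a|%N != a.+1) && (0 < w a <= a.+1%:Z))%:R
                     * (1 - p a.+1) * descent_factor p w a =
    ends (- a.+1%:Z) + (0 < w a.-1 <= a%:Z)%R%:R
                     * (1 - p a) * descent_factor (fun i => p i.+1) w a.
  transitivity (B * C * (ends a.+1%:Z
    + ((`|w a|%N != a.+1) && (0 < w a <= a.+1%:Z))%:R
        * (1 - p a.+1) * descent_factor p w a)); first by rewrite /ends; ring.
  by rewrite balance /ends; ring.
have ins_a x : insert_letter w a x a = x by rewrite /insert_letter ltnn eqxx.
have ins_r x : insert_letter w a x a.+1 = shift_letter a (w a).
  rewrite /insert_letter.
  by have [-> ->] : (a.+1 < a)%N = false /\ (a.+1 == a)%N = false by lia.
(* If 0 < a, the letter before a is unsigned and not fixed. It then lies below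
   an unsigned letter inserted at a exactly if it is deficient, and always
   above a signed one. *)
have left_cmp : p a = 1 \/ [/\ 0 < w a.-1, w a.-1 != a%:Z,
   (a.+1%:Z < insert_letter w a a.+1%:Z a.-1) = (a%:Z < w a.-1) &
   (- a.+1%:Z < insert_letter w a (- a.+1%:Z) a.-1) = true].
  case: a le_am nofix {ends ins_a ins_r} => [|a] le_am nofix; first by left.
  right; move: nofix; rewrite nofix_belowS /= => /andP[_ nofix].
  have := letters le_am; rewrite /insert_letter ltnSn /shift_letter => letter_a.
  split; first lia.
  - lia.
  - by repeat (case: ifP => ?); lia.
  - by repeat (case: ifP => ?); lia.
have letter_a : p a.+1 = 1 \/ (0 < w a \/ w a = - a.+1%:Z).
  move: le_am; rewrite leq_eqVlt => /orP[/eqP->|/letters]; first by left.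
  by right.
rewrite /ends /descent_factor /= !ins_a !ins_r.
have -> : (shift_letter a (w a) < a.+1%:Z) = (w a <= a%:Z).
  by rewrite /shift_letter; repeat (case: ifP => ?); lia.
have -> : (shift_letter a (w a) < - a.+1%:Z) = (w a < - a%:Z).
  by rewrite /shift_letter; repeat (case: ifP => ?); lia.
(* The letter a.+1 would be a fixed point, so only a deficient one is left. *)
have -> : (`|w a|%N != a.+1) && (0 < w a <= a.+1%:Z) = (0 < w a <= a%:Z) by lia.
case: left_cmp => [->|[pos_l nofix_l -> ->]].
  rewrite subrr mulr0 mul0r !if_same !mul1r addr0.
  case: letter_a => [->|letter_a].
    by rewrite !if_same subrr mulr0 mul0r addr0.
  rewrite mulr1; case: (lerP (w a) a%:Z) => ?; case: (ltrP (w a) (- a%:Z)) => ?;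
  case: (ltrP 0 (w a)) => ? /=; try lia; ring.
rewrite pos_l /=.
case: letter_a => [->|letter_a].
  rewrite !if_same; case: (ltrP a%:Z (w a.-1)) => ? /=; ring.
case: (lerP (w a) a%:Z) => ?; case: (ltrP (w a) (- a%:Z)) => ?;
  case: (ltrP 0 (w a)) => ? /=; try lia; case: (ltrP a%:Z (w a.-1)) => ? /=;
  case: (ltrP (w a) (w a.-1)) => ? /=; try lia; ring.
Qed.

(** [defect] is zero at both ends because of the factor [1 - p a], and
    beyond the first fixed point of [w] because of [nofix_below]. *)
Lemma insert_sum :
  \sum_(0 <= a < m.+1 | nofix_below w a)
    (\prod_(0 <= i < m.+2) descent_factor p (insert_letter w a a.+1%:Z) i -
     \prod_(0 <= i < m.+2)
        descent_factor p (insert_letter w a (- a.+1%:Z)) i) = 0.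
Proof.
transitivity (\sum_(0 <= a < m.+1) (- defect a.+1 - - defect a)).
  rewrite [LHS]big_mkcond /=; apply: eq_big_nat => a.
  rewrite andTb ltnS => le_am.
  case: ifP => [nofix|fix_a].
    by rewrite -(addrK (defect a.+1) (bigop _ _ _)) insert_step //; ring.
  by rewrite /defect nofix_belowS fix_a !mul0r subrr.
rewrite telescope_sumr // /defect p0 pm !subrr !mulr0 !mul0r subrr //.
Qed.
End Telescope.

(** * The major index as a weight *)

(** The value 1 at the two ends is what [insert_sum] needs to telescope to 0. *)
Definition boundary_weight (m i : nat) : {poly int} :=
  if (0 < i < m.+1)%N then 'X^i else 1.

Lemma maj_prod (m : nat) (u : seq int) : size u = m.+1 ->
  'X^(maj u) =
  \prod_(0 <= i < m.+2) descent_factor (boundary_weight m) (nth 0 u) i.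
Proof.
move=> size_u; rewrite /maj -prodrXr /Des big_filter size_u /=.
rewrite big_mkcond /= big_ltn // big_nat_recr //=.
rewrite {1 3}/descent_factor /boundary_weight ltxx mul1r ltnn !if_same mulr1.
rewrite /index_iota subSS subn0 !big_seq; apply: eq_bigr => i.
by rewrite mem_iota /descent_factor add1n => ->.
Qed.

(** * Insertion of a fixed point into a decorated permutation *)

Lemma signed_fixed n (d : decperm n) i : i \in dp_signed d -> dp_perm d i = i.
Proof. by move=> /(subsetP (valP d)); rewrite inE => /eqP. Qed.

Lemma insert_subproof m (e : decperm m) (a : 'I_m.+1) (sg : bool) :
  (if sg then [set a] else set0) :|: lift a @: dp_signed e
    \subset [set i | lift_perm a a (dp_perm e) i == i].
Proof.
apply/subsetP => i; rewrite !inE => /orP[|/imsetP[j /signed_fixed fix_j ->]].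
  by case: sg; rewrite !inE // => /eqP ->; rewrite lift_perm_id.
by rewrite lift_perm_lift fix_j.
Qed.

Definition insert_fixed m (x : decperm m * 'I_m.+1 * bool) : decperm m.+1 :=
  DecPerm (dp_val := (lift_perm x.1.2 x.1.2 (dp_perm x.1.1),
     (if x.2 then [set x.1.2] else set0) :|: lift x.1.2 @: dp_signed x.1.1))
    (insert_subproof x.1.1 x.1.2 x.2).

Section Insert.
Variables (m : nat) (e : decperm m) (a : 'I_m.+1) (sg : bool).
Let d := insert_fixed (e, a, sg).

Lemma insert_perm_lift i : dp_perm d (lift a i) = lift a (dp_perm e i).
Proof. by rewrite /dp_perm /= lift_perm_lift. Qed.

Lemma insert_perm_id : dp_perm d a = a.
Proof. by rewrite /dp_perm /= lift_perm_id. Qed.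

Lemma insert_signed_lift i : (lift a i \in dp_signed d) = (i \in dp_signed e).
Proof.
rewrite /dp_signed /= inE mem_imset; last exact: lift_inj.
by case: sg; rewrite inE // -(inj_eq val_inj) /= eq_sym (negPf (neq_bump _ _)).
Qed.

Lemma insert_signed_id : (a \in dp_signed d) = sg.
Proof.
rewrite /dp_signed /= inE [X in _ || X](_ : _ = false) ?orbF.
  by case: sg; rewrite inE ?eqxx.
by apply/imsetP=> -[j _ /eqP]; rewrite (negPf (neq_lift _ _)).
Qed.

Lemma nfix_insert : nfix d = (sg + nfix e)%N.
Proof.
rewrite /nfix {1}/dp_signed /= cardsU card_imset; last exact: lift_inj.
rewrite (_ : _ :&: _ = set0) ?cards0 ?subn0.
  by case: sg; rewrite ?cards1 ?cards0.
apply/setP=> i; rewrite !inE; apply/andP => -[].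
case: sg; rewrite inE // => /eqP -> /imsetP[j _ /eqP].
by rewrite (negPf (neq_lift _ _)).
Qed.

End Insert.

Lemma size_dp_word n (d : decperm n) : size (dp_word d) = n.
Proof. by rewrite size_map size_enum_ord. Qed.

Lemma nth_dp_word n (d : decperm n) (i : 'I_n) :
  nth 0 (dp_word d) i = dp_letter d i.
Proof. by rewrite (nth_map i) ?size_enum_ord // nth_ord_enum. Qed.

Lemma dp_letter_sign n (d : decperm n) (i : 'I_n) :
  0 < dp_letter d i \/ dp_letter d i = - i.+1%:Z.
Proof. by rewrite /dp_letter; case: ifP => _; [right|left]. Qed.

Lemma dp_letter_fixed n (d : decperm n) (i : 'I_n) :
  (`|dp_letter d i|%N == i.+1) = (dp_perm d i == i).
Proof.
rewrite /dp_letter; case: ifP => [/signed_fixed ->|_].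
  by rewrite abszN !eqxx.
by rewrite /= eqSS.
Qed.

Lemma dp_letter_insert m (e : decperm m) (a : 'I_m.+1) sg (i : 'I_m) :
  dp_letter (insert_fixed (e, a, sg)) (lift a i) =
  shift_letter a (dp_letter e i).
Proof.
rewrite /dp_letter insert_signed_lift insert_perm_lift /= /shift_letter /bump.
case: (i \in _) => /=; repeat (case: ifP => ?); lia.
Qed.

Lemma nth_insert m (e : decperm m) (a : 'I_m.+1) sg i : (i < m.+1)%N ->
  nth 0 (dp_word (insert_fixed (e, a, sg))) i =
  insert_letter (nth 0 (dp_word e)) a (if sg then - a.+1%:Z else a.+1%:Z) i.
Proof.
move=> lt_im; rewrite -[i]/(val (Ordinal lt_im)) nth_dp_word /insert_letter.
case: (unliftP a (Ordinal lt_im)) => [j ->|->].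
  rewrite dp_letter_insert /= -(nth_dp_word e j) /bump.
  case: (leqP a j) => le_aj.
    by rewrite add1n /= ltnNge eq_sym (leqW le_aj) /= ltn_eqF // ltnS.
  by rewrite add0n le_aj.
rewrite ltnn eqxx /dp_letter insert_signed_id insert_perm_id.
by case: sg.
Qed.

Lemma nofix_belowP n (d : decperm n) (a : nat) : (a <= n)%N ->
  reflect (forall i : 'I_n, (i < a)%N -> dp_perm d i != i)
          (nofix_below (nth 0 (dp_word d)) a).
Proof.
move=> le_an; apply: (iffP allP) => nofix i.
  move=> lt_ia; have := nofix i.
  by rewrite mem_iota nth_dp_word dp_letter_fixed; apply.
rewrite mem_iota => /= lt_ia; have lt_in := leq_trans lt_ia le_an.
by have := nofix (Ordinal lt_in); rewrite -dp_letter_fixed -nth_dp_word; apply.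
Qed.

(** The insertions whose new fixed point is the least one of the result. *)
Definition least_insertions m : {set decperm m * 'I_m.+1 * bool} :=
  [set x : decperm m * 'I_m.+1 * bool |
    nofix_below (nth 0 (dp_word x.1.1)) x.1.2].

Lemma insert_fixed_below m x (i : 'I_m.+1) : x \in least_insertions m ->
  dp_perm (insert_fixed x) i = i -> (x.1.2 <= i)%N.
Proof.
case: x => [[e a] sg]; rewrite inE /= => nofix_a.
have /nofix_belowP nofix := nofix_a.
case: (unliftP a i) => [j ->|->] //.
rewrite insert_perm_lift => /lift_inj fix_j.
rewrite leqNgt; apply/negP => /= lt_ja.
have /(nofix (ltn_ord a)) : (j < a)%N.
  by move: lt_ja; rewrite /= /bump; case: leqP => ?; lia.
by rewrite fix_j eqxx.
Qed.

(** The inserted position is recovered as the least fixed point; its sign and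
    the smaller decorated permutation can then be read off. *)
Lemma insert_fixed_inj m :
  {in least_insertions m &, injective (@insert_fixed m)}.
Proof.
move=> [[e a] sg] [[e' a'] sg'] leastx leastx' eq_d.
have eq_a : a = a'.
  apply/val_inj/anti_leq/andP; split.
    by apply: (insert_fixed_below leastx); rewrite eq_d insert_perm_id.
  by apply: (insert_fixed_below leastx'); rewrite -eq_d insert_perm_id.
subst a'.
have -> : sg = sg' by rewrite -(insert_signed_id e a sg) eq_d insert_signed_id.
suff -> : e = e' by [].
apply: val_inj; rewrite /= [dp_val e]surjective_pairing.
rewrite [dp_val e']surjective_pairing.
congr (_, _).
  apply/permP => i; apply: (@lift_inj _ a).
  rewrite -[_.1]/(dp_perm e) -[_.1]/(dp_perm e').
  by rewrite -(insert_perm_lift e a sg) eq_d insert_perm_lift.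
apply/setP => i.
rewrite -[_.2]/(dp_signed e) -[_.2]/(dp_signed e').
by rewrite -(insert_signed_lift e a sg) eq_d insert_signed_lift.
Qed.

(** Deleting the least fixed point is the inverse operation. *)
Lemma insert_fixed_onto m : @insert_fixed m @: least_insertions m = G m.+1.
Proof.
apply/setP => d; apply/imsetP/idP => [[[[e a] sg] _ ->]|].
  by rewrite inE; apply/existsP; exists a; rewrite insert_perm_id.
rewrite inE => /existsP[a0 fix_a0].
have [a /eqP fix_a least_a] :=
  @arg_minnP _ a0 (fun i => dp_perm d i == i) val fix_a0.
(* The default k is never used: only a is sent to a. *)
pose f k := odflt k (unlift a (dp_perm d (lift a k))).
have lift_f k : lift a (f k) = dp_perm d (lift a k).
  rewrite /f; case: unliftP => [j ->|] //=.
  move=> perm_lift; have /perm_inj/eqP : dp_perm d a = dp_perm d (lift a k).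
    by rewrite fix_a perm_lift.
  by rewrite (negPf (neq_lift _ _)).
have f_inj : injective f.
  by move=> i j /(congr1 (lift a)); rewrite !lift_f => /perm_inj/lift_inj.
have sub_f : lift a @^-1: dp_signed d \subset [set i | perm f_inj i == i].
  apply/subsetP => i; rewrite !inE permE => /signed_fixed fix_i.
  by rewrite -(inj_eq (@lift_inj _ a)) lift_f fix_i.
pose e := DecPerm (dp_val := (perm f_inj, lift a @^-1: dp_signed d)) sub_f.
have perm_e i : dp_perm e i = f i by rewrite /dp_perm permE.
exists (e, a, a \in dp_signed d).
  rewrite inE; apply/nofix_belowP => [|i /= lt_ia].
    by rewrite -ltnS ltn_ord.
  apply: contraTneq lt_ia; rewrite perm_e => fix_i; rewrite -leqNgt.
  have := least_a (lift a i); rewrite -lift_f fix_i eqxx => /(_ isT) /=.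
  rewrite /bump; lia.
apply: val_inj; rewrite /= [LHS]surjective_pairing.
rewrite -/(dp_perm d) -/(dp_signed d).
congr (_, _).
  apply/permP => i; case: (unliftP a i) => [j ->|->].
    by rewrite lift_perm_lift perm_e lift_f.
  by rewrite lift_perm_id.
apply/setP => i.
rewrite -[RHS]/(i \in dp_signed (insert_fixed (e, a, a \in dp_signed d))).
case: (unliftP a i) => [j ->|->].
  by rewrite insert_signed_lift /dp_signed /= inE.
by rewrite insert_signed_id.
Qed.

(** * Cancellation of signed against unsigned insertions *)

Lemma insertions_cancel m (e : decperm m) :
  \sum_(a < m.+1 | nofix_below (nth 0 (dp_word e)) a) \sum_(sg : bool)
     (-1) ^+ nfix (insert_fixed (e, a, sg)) *
       'X^(maj (dp_word (insert_fixed (e, a, sg)))) = 0 :> {poly int}.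
Proof.
have letters i : (i < m)%N ->
    0 < nth 0 (dp_word e) i \/ nth 0 (dp_word e) i = - i.+1%:Z.
  move=> lt_im; have := dp_letter_sign e (Ordinal lt_im).
  by rewrite -nth_dp_word.
have p0 : boundary_weight m 0 = 1 by [].
have pm : boundary_weight m m.+1 = 1 by rewrite /boundary_weight ltnn.
have weight a sg :
    'X^(maj (dp_word (insert_fixed (e, a, sg)))) =
    \prod_(0 <= i < m.+2) descent_factor (boundary_weight m)
      (insert_letter (nth 0 (dp_word e)) a
         (if sg then - a.+1%:Z else a.+1%:Z)) i.
  rewrite (maj_prod (size_dp_word _)); apply: eq_big_nat => i /andP[_].
  rewrite ltnS leq_eqVlt => /predU1P[->|lt_im].
    by rewrite /descent_factor pm !if_same.
  by rewrite /descent_factor !nth_insert ?(leq_ltn_trans (leq_pred i)).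
have := insert_sum letters p0 pm; rewrite big_mkord => cancel.
move/(congr1 ( *%R ((-1) ^+ nfix e))): cancel.
rewrite mulr0 mulr_sumr => cancel; rewrite -[RHS]cancel.
apply: eq_bigr => a _.
rewrite big_bool /= !weight !nfix_insert add1n add0n exprS; ring.
Qed.

Theorem theorem1p5 (n : nat) (n_gt0 : (0 < n)%N) :
  \sum_(d in G n) (-1) ^+ nfix d * 'X^(maj (dp_word d)) = 0 :> {poly int}.
Proof.
case: n n_gt0 => // m _.
rewrite -insert_fixed_onto big_imset /=; last exact: insert_fixed_inj.
have vanish : \sum_(e : decperm m) 0 = 0 :> {poly int} by rewrite big1_eq.
rewrite -(eq_bigr _ (fun e _ => insertions_cancel e)) 2!pair_big_dep in vanish.
rewrite -[RHS]vanish.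
by apply: eq_big => [[[e a] sg]|[[e a] sg] _] //; rewrite inE /= andbT.
Qed.
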